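(* Fix a measurable function $f:\Omega\to[0,\infty]$, and define $$f^*(\omega):=\sup_{n\ge0}f(\sigma^n(\omega))\qquad(\omega\in\Omega).$$ Then $f^*:\Omega\to[0,\infty]$ is measurable. Moreover, for every $n\ge0$ one has $X_{f^*}\subset X_{f\circ\sigma^n}$, and the kernel inequality $$L^nJ_f\le J_{f^*}$$ holds in the Loewner order on $X_{f^*}$. In addition, $J_{f^*}$ is $L$-superharmonic in the sense that $$LJ_{f^*}\le J_{f^*}$$ in the Loewner order on $X_{f^*}$.
   Context: Let $X$ be a set, $m\ge1$ an integer, and $\varphi_1,\dots,\varphi_m:X\to X$ maps. A kernel $J:Y\times Y\to\mathbb{C}$ is positive definite if $\sum_{\alpha,\beta}\overline{c_\alpha}c_\beta J(s_\alpha,s_\beta)\ge0$ for all finite families $(c_\alpha,s_\alpha)\in\mathbb{C}\times Y$; in the Loewner (kernel) order, $J_1\le J_2$ on $Y$ means that $J_2-J_1$ is positive definite on $Y$. The pullback operator is $(LJ)(s,t):=\sum_{i=1}^m J(\varphi_i(s),\varphi_i(t))$. Fix a positive definite kernel $K$ on $X$ with $LK\ge K$. Set $K_0:=K$, $K_{n+1}:=LK_n$, $u_n(s):=K_n(s,s)$ (nondecreasing in $n$), $u_\infty(s):=\lim_nu_n(s)\in[0,\infty]$, $X_{\mathrm{fin}}:=\{s\in X:u_\infty(s)<\infty\}$. Each $\varphi_i$ maps $X_{\mathrm{fin}}$ into itself. For $s,t\in X_{\mathrm{fin}}$ the limit $K_\infty(s,t):=\lim_nK_n(s,t)$ exists;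 $K_\infty$ is positive definite on $X_{\mathrm{fin}}$ and $LK_\infty=K_\infty$ there; $K_\infty(s,s)=u_\infty(s)$. Words: $W_n:=\{1,\dots,m\}^n$, $W_0=\{\emptyset\}$; for $w=i_1\cdots i_n\in W_n$, $\varphi_w:=\varphi_{i_n}\circ\cdots\circ\varphi_{i_1}$ ($\varphi_\emptyset=\mathrm{id}$). Thus $(L^nJ)(s,t)=\sum_{w\in W_n}J(\varphi_w(s),\varphi_w(t))$. $\Omega:=\{1,\dots,m\}^{\mathbb{N}}$ with product $\sigma$-algebra and product probability measure $\mu$ making the coordinates independent and uniform on $\{1,\dots,m\}$. For $\omega=\omega_1\omega_2\cdots\in\Omega$, $\omega|n:=\omega_1\cdots\omega_n\in W_n$ ($\omega|0=\emptyset$); $\sigma:\Omega\to\Omega$ is the left shift $\sigma(\omega_1\omega_2\cdots)=\omega_2\omega_3\cdots$. For $s,t\in X_{\mathrm{fin}}$, $M_n(s,t;\omega):=m^nK_\infty(\varphi_{\omega|n}(s),\varphi_{\omega|n}(t))$. For $s\in X_{\mathrm{fin}}$ let $B(s):=\sup_{n\ge0}\{m^n\sum_{w\in W_n}u_\infty(\varphi_w(s))^2\}\in[0,\infty]$, and $X_2:=\{s\in X_{\mathrm{fin}}:B(s)<\infty\}$; each $\varphi_k$ maps $X_2$ into itself. For $s,t\in X_2$, $M_n(s,t;\cdot)$ converges in $L^2(\Omega,\mu)$ and $\mu$-almost surely; $M_\infty(s,t;\cdot)\in L^2(\Omega,\mu)$ denotes (a fixed measurable version of) the limit, with $M_\infty(s,s;\cdot)\ge0$;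 $h(s;\omega):=M_\infty(s,s;\omega)\in[0,\infty)$. For measurable $f:\Omega\to[0,\infty]$ let $X_f:=\{s\in X_2:\int_\Omega f(\omega)h(s;\omega)\,d\mu(\omega)<\infty\}$ and, for $s,t\in X_f$, $J_f(s,t):=\int_\Omega f(\omega)M_\infty(s,t;\omega)\,d\mu(\omega)$, with the convention $\infty\cdot0=0$; this integral converges absolutely for $s,t\in X_f$. If $s\in X_{f\circ\sigma^n}$ then $\varphi_w(s)\in X_f$ for every $w\in W_n$, so $L^nJ_f$ is defined on $X_{f\circ\sigma^n}$ by the formula above. *)

(* Defs.v *)
From HB Require Import structures.
From mathcomp Require Import all_boot all_order all_algebra.
From mathcomp Require Import finmap complex.
From mathcomp Require Import all_classical all_reals all_analysis.
From mathcomp Require Import measurable_realfun.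

Set Implicit Arguments.
Unset Strict Implicit.
Unset Printing Implicit Defensive.

Import Order.TTheory GRing.Theory Num.Theory.
Import numFieldNormedType.Exports.

Local Open Scope classical_set_scope.
Local Open Scope ring_scope.

Section Kernels.
Variables (R : realType) (X : Type).
Implicit Types (Y : set X) (J : X -> X -> R[i]).

(** In [R[i]], [0 <= z] says that [z] is real and nonnegative. *)
Definition posdef Y J : Prop :=
  forall (n : nat) (c : 'I_n -> R[i]) (s : 'I_n -> X),
    (forall a, Y (s a)) ->
    0 <= \sum_(a < n) \sum_(b < n) (c a)^* * c b * J (s a) (s b).

Definition loewner_le Y J1 J2 : Prop :=
  posdef Y (fun s t => J2 s t - J1 s t).

End Kernels.

(** The number of maps is [m.+1], so that the alphabet ['I_m.+1] is nonempty. *)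
Section Words.
Variables (R : realType) (X : Type) (m : nat) (phi : 'I_m.+1 -> X -> X).

Definition pullback (J : X -> X -> R[i]) : X -> X -> R[i] :=
  fun s t => \sum_(i < m.+1) J (phi i s) (phi i t).

(** The first letter acts first: [phiw [:: i1; ..; ik]] is
    [phi ik \o .. \o phi i1]. *)
Definition phiw (w : seq 'I_m.+1) (s : X) : X := foldl (fun x i => phi i x) s w.

Definition pullback_pow (n : nat) (J : X -> X -> R[i]) : X -> X -> R[i] :=
  fun s t => \sum_(w : n.-tuple 'I_m.+1) J (phiw w s) (phiw w t).

End Words.

Section Limits.
Variables (R : realType) (X : Type) (m : nat) (phi : 'I_m.+1 -> X -> X).
Variable K : X -> X -> R[i].

Definition Kn (n : nat) : X -> X -> R[i] := iter n (pullback phi) K.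

(** [Kn n s s] is real when [K] is positive definite. *)
Definition un (n : nat) (s : X) : \bar R := (complex.Re (Kn n s s))%:E.

Definition uoo (s : X) : \bar R := limn (un ^~ s).

Definition Xfin : set X := [set s | (uoo s < +oo)%E].

(** [R[i]^o] carries the topology of the modulus. *)
Definition Koo (s t : X) : R[i] := lim ((Kn n s t : R[i]^o) @[n --> \oo]).

Definition Bsup (s : X) : \bar R :=
  ereal_sup [set ((m.+1 ^ n)%:R%:E *
    \sum_(w : n.-tuple 'I_m.+1) uoo (phiw phi w s) ^+ 2)%E | n in [set: nat]].

Definition X2 : set X := [set s | Xfin s /\ (Bsup s < +oo)%E].

End Limits.

HB.instance Definition _ (m : nat) := isPointed.Build 'I_m.+1 ord0.

Section PathSpace.
Variable m : nat.

(** Generators of the product sigma-algebra, each factor ['I_m.+1] being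
    discrete. *)
Definition cylinders : set (set (nat -> 'I_m.+1)) :=
  [set A | exists (i : nat) (C : set 'I_m.+1), A = [set w | C (w i)]].

Definition Omega := g_sigma_algebraType cylinders.

Definition path_shift (w : Omega) : Omega := fun n => w n.+1.

Definition prefix_word (w : Omega) (n : nat) : seq 'I_m.+1 := mkseq w n.

(** Uniformity and independence of the coordinates determine the product
    probability measure on [Omega]. *)
Definition uniform_coordinates (R : realType) (mu : probability Omega R) : Prop :=
  forall (i : nat) (k : 'I_m.+1), mu [set w | w i = k] = (m.+1%:R^-1)%:E.

Definition independent_coordinates (R : realType) (mu : probability Omega R)
    : Prop :=
  forall (I : {fset nat}) (C : nat -> set 'I_m.+1),
    mu [set w | forall i, i \in I -> C i (w i)] =
    (\prod_(i <- I) mu [set w | C i (w i)])%E.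

End PathSpace.

Section Martingale.
Variables (R : realType) (X : Type) (m : nat) (phi : 'I_m.+1 -> X -> X).
Variables (K : X -> X -> R[i]) (mu : probability (Omega m) R).

Definition Mn (n : nat) (s t : X) (w : Omega m) : R[i] :=
  (m.+1 ^ n)%:R *
  Koo phi K (phiw phi (prefix_word w n) s) (phiw phi (prefix_word w n) t).

Definition cabs (g : Omega m -> R[i]) (w : Omega m) : \bar R :=
  (ComplexField.Normc.normc (g w))%:E.

(** [Moo s t] is a measurable version of the limit of [Mn ^~ s t], in [L^2] and
    almost surely, for [s] and [t] in [X2]; its other values are irrelevant. *)
Definition is_martingale_limit (Moo : X -> X -> Omega m -> R[i]) : Prop :=
  (forall s t, X2 phi K s -> X2 phi K t ->
    [/\ measurable_fun [set: Omega m] (fun w => complex.Re (Moo s t w))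
        /\ measurable_fun [set: Omega m] (fun w => complex.Im (Moo s t w)),
        ('N[mu]_2[cabs (Moo s t)] < +oo)%E,
        ('N[mu]_2[cabs (fun w => Mn n s t w - Moo s t w)%R])%E
          @[n --> \oo] --> 0%E &
        {ae mu, forall w, Mn n s t w @[n --> \oo] --> (Moo s t w : R[i]^o)}]) /\
  (forall s, X2 phi K s -> forall w, 0 <= Moo s s w).

End Martingale.

Section WeightedKernels.
Variables (R : realType) (X : Type) (m : nat) (phi : 'I_m.+1 -> X -> X).
Variables (K : X -> X -> R[i]) (mu : probability (Omega m) R).
Variables (Moo : X -> X -> Omega m -> R[i]) (f : Omega m -> \bar R).

(** [Moo s s w] is real, and nonnegative, for [s] in [X2]. *)
Definition hdiag (s : X) (w : Omega m) : R := complex.Re (Moo s s w).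

Definition Xw : set X :=
  [set s | X2 phi K s /\ (\int[mu]_w (f w * (hdiag s w)%:E) < +oo)%E].

(** The complex integral of [f * Moo s t]. For [s] and [t] in [Xw] both
    components are integrable, so [fine] forgets no infinite value; in [\bar R],
    [+oo * 0 = 0]. *)
Definition Jw (s t : X) : R[i] :=
  Complex (fine (\int[mu]_w (f w * (complex.Re (Moo s t w))%:E)))
          (fine (\int[mu]_w (f w * (complex.Im (Moo s t w))%:E))).

End WeightedKernels.

Definition fstar (R : realType) (m : nat) (f : Omega m -> \bar R)
    (w : Omega m) : \bar R :=
  ereal_sup [set f (iter n (@path_shift m) w) | n in [set: nat]].

(* Main.v *)
Require Import Defs.
From HB Require Import structures.
From mathcomp Require Import all_boot all_order all_algebra.
From mathcomp Require Import finmap complex.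
From mathcomp Require Import all_classical all_reals all_analysis.
From mathcomp Require Import measurable_realfun.
From mathcomp Require Import ring lra.

(** The theorem rests on two properties of the map [g |-> Jw g].

    It is monotone: if [g1 <= g2] then [Jw g1 <= Jw g2] in the Loewner order on
    [Xw g2] ([Jw_le]), because [Jw g2 - Jw g1] integrates the nonnegative weight
    [g2 - g1] against [Moo], and [Moo] is almost surely positive definite on any
    finite family of points, as a limit of the positive definite kernels [Mn n]
    ([Moo_posdef]). An infinite value of [g2] does no harm: for [s] in [Xw g2]
    the function [h s] vanishes almost surely where [g2] is infinite, and the
    diagonal dominates the other entries ([Moo_eq0]).

    It intertwines the shift with the pullback: [Jw (g \o path_shift)] is the
    pullback of [Jw g] on [Xw (g \o path_shift)] ([Jw_shift]). Indeed the
    martingale satisfies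
    [Mn n.+1 s t (k w) = m.+1 * Mn n (phi k s) (phi k t) w], where [k w] is the
    path [w] with the letter [k] in front, so that
    [Moo s t (k w) = m.+1 * Moo (phi k s) (phi k t) w] almost surely
    ([Moo_path_cons]); and [mu] is the average over [k] of its images under
    [w |-> k w] ([path_measureE]), so that integrating over [k] cancels the
    factor [m.+1]. By induction, [Jw (g \o path_shift^n)] is the [n]-th iterated
    pullback of [Jw g] ([Jw_pullback_pow]).

    Since [f \o path_shift^n <= fstar f], monotonicity gives the first
    inequality; since [fstar f \o path_shift <= fstar f], it gives the
    superharmonicity of [Jw (fstar f)].

    The positive definiteness of [Koo] is proved beforehand: on [Xfin] the
    iterates [Kn] increase in the Loewner order and have bounded diagonals,
    which makes every entry converge ([cvg_Kn]). *)

Set Implicit Arguments.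
Unset Strict Implicit.
Unset Printing Implicit Defensive.

Import Order.TTheory GRing.Theory Num.Theory.
Import numFieldNormedType.Exports.

Local Open Scope classical_set_scope.
Local Open Scope ring_scope.

(** * Limits of complex sequences through real and imaginary parts *)

Section ComplexLimits.
Variable R : realType.
Implicit Types z : R[i].

Lemma ReM z z' : complex.Re (z * z') =
  complex.Re z * complex.Re z' - complex.Im z * complex.Im z'.
Proof. by case: z z' => [a b] [c d]. Qed.

Lemma ImM z z' : complex.Im (z * z') =
  complex.Re z * complex.Im z' + complex.Im z * complex.Re z'.
Proof. by case: z z' => [a b] [c d]. Qed.

Lemma Re_sum I (r : seq I) (P : pred I) (F : I -> R[i]) :
  complex.Re (\sum_(i <- r | P i) F i) = \sum_(i <- r | P i) complex.Re (F i).
Proof. by elim/big_ind2: _ => // _ [x y] _ [x' y'] <- <-. Qed.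

Lemma Im_sum I (r : seq I) (P : pred I) (F : I -> R[i]) :
  complex.Im (\sum_(i <- r | P i) F i) = \sum_(i <- r | P i) complex.Im (F i).
Proof. by elim/big_ind2: _ => // _ [x y] _ [x' y'] <- <-. Qed.

Lemma ReB z z' : complex.Re (z - z') = complex.Re z - complex.Re z'.
Proof. by case: z z' => [a b] [c d]. Qed.

Lemma ImB z z' : complex.Im (z - z') = complex.Im z - complex.Im z'.
Proof. by case: z z' => [a b] [c d]. Qed.

Lemma complex_ge0 z : (0 <= z) = (complex.Im z == 0) && (0 <= complex.Re z).
Proof. by rewrite lecE. Qed.

Lemma Im_le_norm z : `|complex.Im z|%:C%C <= `|z|.
Proof.
case: z => a b; rewrite normc_def lecR/= -sqrtr_sqr.
rewrite ler_sqrt ?addr_ge0 ?sqr_ge0//.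
by rewrite lerDr sqr_ge0.
Qed.

Lemma norm_le_ReIm z : `|z| <= (`|complex.Re z| + `|complex.Im z|)%:C%C.
Proof.
case: z => a b; rewrite normc_def lecR/=.
rewrite -[leRHS]ger0_norm ?addr_ge0// -sqrtr_sqr ler_sqrt ?sqr_ge0//.
rewrite sqrrD !real_normK ?num_real// -addrA lerD2l.
by rewrite lerDr mulrn_wge0// mulr_ge0.
Qed.

Section Filter.
Variables (T : Type) (F : set_system T).
Context {FF : Filter F}.

Lemma cvg_Re (z : T -> R[i]) (l : R[i]) :
  (z x : R[i]^o) @[x --> F] --> (l : R[i]^o) ->
  complex.Re (z x) @[x --> F] --> complex.Re l.
Proof.
move=> /cvgrPdist_lt zl; apply/cvgrPdist_lt => e e0.
have := zl e%:C%C; rewrite ltcR => /(_ e0); apply: filterS => x.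
rewrite -ltcR; apply: le_lt_trans; rewrite -ReB; exact: normc_ge_Re.
Qed.

Lemma cvg_Im (z : T -> R[i]) (l : R[i]) :
  (z x : R[i]^o) @[x --> F] --> (l : R[i]^o) ->
  complex.Im (z x) @[x --> F] --> complex.Im l.
Proof.
move=> /cvgrPdist_lt zl; apply/cvgrPdist_lt => e e0.
have := zl e%:C%C; rewrite ltcR => /(_ e0); apply: filterS => x.
rewrite -ltcR; apply: le_lt_trans; rewrite -ImB; exact: Im_le_norm.
Qed.

Lemma cvg_Complex (z : T -> R[i]) (a b : R) :
  complex.Re (z x) @[x --> F] --> a -> complex.Im (z x) @[x --> F] --> b ->
  (z x : R[i]^o) @[x --> F] --> (Complex a b : R[i]^o).
Proof.
move=> /cvgrPdist_lt za /cvgrPdist_lt zb; apply/cvgrPdist_lt => e.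
rewrite ltcE/= => /andP[/eqP ei e0].
have e2 : 0 < complex.Re e / 2 by rewrite divr_gt0.
near=> x; apply: le_lt_trans (norm_le_ReIm _) _.
rewrite ltcE/= ei eqxx/= ReB ImB/=.
rewrite [ltRHS]splitr ltrD//; near: x; [exact: za|exact: zb].
Unshelve. all: by end_near. Qed.

End Filter.
End ComplexLimits.

(** * Positive definite kernels *)

Section PositiveDefinite.
Variables (R : realType) (X : Type).
Implicit Types (Y : set X) (J : X -> X -> R[i]).

Lemma posdef2 Y J s t (c d : R[i]) : posdef Y J -> Y s -> Y t ->
  0 <= c^* * c * J s s + c^* * d * J s t
       + (d^* * c * J t s + d^* * d * J t t).
Proof.
move=> Jpos Ys Yt.
have := Jpos 2%N (fun i => if i == 0 :> nat then c else d)
  (fun i => if i == 0 :> nat then s else t).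
by rewrite !big_ord_recl !big_ord0/= !addr0; apply=> a; case: ifP.
Qed.

Lemma posdef_diag Y J s : posdef Y J -> Y s -> 0 <= J s s.
Proof.
move=> Jpos Ys; have := posdef2 1 0 Jpos Ys Ys.
by rewrite conjC1 conjC0 !mul1r !(mulr0, mul0r, addr0).
Qed.

Lemma posdef_diag_Re Y J s : posdef Y J -> Y s -> 0 <= complex.Re (J s s).
Proof. by move=> Jp /(posdef_diag Jp); rewrite complex_ge0 => /andP[]. Qed.

(** A cheap substitute for the Cauchy-Schwarz inequality: positivity of the
    quadratic form at the coefficients [(1, u)], [u] a fourth root of unity,
    bounds the real and imaginary parts of an entry by the diagonal. *)
Lemma posdef_dominated Y J s t : posdef Y J -> Y s -> Y t ->
  2 * `|complex.Re (J s t)| <= complex.Re (J s s) + complex.Re (J t t) /\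
  2 * `|complex.Im (J s t)| <= complex.Re (J s s) + complex.Re (J t t).
Proof.
move=> Jpos Ys Yt.
have Hs := posdef_diag Jpos Ys; have Ht := posdef_diag Jpos Yt.
have H1 := posdef2 1 1 Jpos Ys Yt.
have H2 := posdef2 1 (-1) Jpos Ys Yt.
have H3 := posdef2 1 (Complex 0 1) Jpos Ys Yt.
have H4 := posdef2 1 (Complex 0 (-1)) Jpos Ys Yt.
move: Hs Ht H1 H2 H3 H4; rewrite !complex_ge0.
case: (J s s) (J s t) (J t s) (J t t) => [a a'] [b b'] [c c'] [d d'] /=.
do 6 (move=> /andP[/eqP ? ?]).
have N (x y : R) : - y <= 2 * x -> 2 * x <= y -> 2 * `|x| <= y.
  by move=> ? ?; case: (ger0P x) => ?; lra.
by split; apply: N; lra.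
Qed.

Lemma posdef_lim Y (Jn : nat -> X -> X -> R[i]) J :
  (forall n, posdef Y (Jn n)) ->
  (forall s t, Y s -> Y t ->
     (Jn n s t : R[i]^o) @[n --> \oo] --> (J s t : R[i]^o)) ->
  posdef Y J.
Proof.
move=> Jpos Jcvg n c s Ys.
pose Q (A : X -> X -> R[i]) := \sum_(a < n) \sum_(b < n)
  (c a)^* * c b * A (s a) (s b).
have QJ : (Q (Jn k) : R[i]^o) @[k --> \oo] --> (Q J : R[i]^o).
  apply: cvg_big => [|a _]; first exact: add_continuous.
  apply: cvg_big => [|b _]; first exact: add_continuous.
  by apply: cvgMl_tmp; exact: Jcvg.
have Q0 k : 0 <= Q (Jn k) by exact: Jpos.
rewrite -/(Q J) complex_ge0; apply/andP; split.
  have /cvg_Im QI := QJ.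
  rewrite -(cvg_lim _ QI)//; apply/eqP/(@cvg_lim R) => //.
  rewrite (_ : (fun k => _) = fun=> 0); first exact: cvg_cst.
  by apply/funext => k; have := Q0 k; rewrite complex_ge0 => /andP[/eqP].
have /cvg_Re QR := QJ; rewrite -(cvg_lim _ QR)//.
apply: limr_ge; first by apply/cvg_ex; eexists; exact: QR.
by apply: nearW => k; have := Q0 k; rewrite complex_ge0 => /andP[].
Qed.

Lemma posdefS Y Y' J : Y `<=` Y' -> posdef Y' J -> posdef Y J.
Proof. by move=> YY' Jpos n c s Ys; apply: Jpos => a; exact: YY'. Qed.

Lemma posdef_comp Y Y' J (phi : X -> X) : (forall s, Y s -> Y' (phi s)) ->
  posdef Y' J -> posdef Y (fun s t => J (phi s) (phi t)).
Proof.
move=> YY' Jpos n c s Ys.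
by apply: (Jpos n c (phi \o s)) => a; exact: YY'.
Qed.

Lemma posdef_sum Y I (r : seq I) (J : I -> X -> X -> R[i]) :
  (forall i, posdef Y (J i)) -> posdef Y (fun s t => \sum_(i <- r) J i s t).
Proof.
move=> Jpos n c s Ys.
under eq_bigr do (under eq_bigr do rewrite mulr_sumr; rewrite exchange_big/=).
by rewrite exchange_big/= sumr_ge0// => i _; exact: Jpos.
Qed.

Lemma posdefZ Y J (a : R[i]) : 0 <= a -> posdef Y J ->
  posdef Y (fun s t => a * J s t).
Proof.
move=> a0 Jpos n c s Ys.
under eq_bigr do (under eq_bigr do rewrite mulrCA; rewrite -mulr_sumr).
by rewrite -mulr_sumr mulr_ge0//; exact: Jpos.
Qed.

End PositiveDefinite.

(** * Iterated pullbacks and their limit *)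

Lemma big_tuple_cons (I : finType) (T : Type) (x0 : T) (op : Monoid.com_law x0)
    n (F : seq I -> T) :
  \big[op/x0]_(w : n.+1.-tuple I) F w =
  \big[op/x0]_(k : I) \big[op/x0]_(w : n.-tuple I) F (k :: w).
Proof.
rewrite pair_big/=.
rewrite (reindex (fun p : I * n.-tuple I => [tuple of p.1 :: p.2]))//=.
exists (fun w : n.+1.-tuple I => (thead w, [tuple of behead w])) => /= x _.
  by case: x => k w /=; congr pair; exact: val_inj.
by rewrite [RHS]tuple_eta; exact: val_inj.
Qed.

Section KernelLimit.
Variables (R : realType) (X : Type) (m : nat) (phi : 'I_m.+1 -> X -> X).

Lemma posdef_pullback Y Y' (J : X -> X -> R[i]) :
  (forall k s, Y s -> Y' (phi k s)) -> posdef Y' J -> posdef Y (pullback phi J).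
Proof.
by move=> YY' Jpos; apply: posdef_sum => i; exact: (posdef_comp (YY' i) Jpos).
Qed.

Lemma pullback_powS n (J : X -> X -> R[i]) s t :
  pullback_pow phi n.+1 J s t = \sum_(k < m.+1)
    pullback_pow phi n J (phi k s) (phi k t).
Proof.
exact: (@big_tuple_cons _ R[i] 0 +%R _
  (fun w => J (phiw phi w s) (phiw phi w t))).
Qed.

Variable K : X -> X -> R[i].
Hypothesis K_posdef : posdef [set: X] K.
Hypothesis K_le_LK : loewner_le [set: X] K (pullback phi K).

Lemma Kn_posdef n : posdef [set: X] (Kn phi K n).
Proof. by elim: n => [|n IH]//; exact: posdef_pullback IH. Qed.

Lemma Kn_nondecreasing n : loewner_le [set: X] (Kn phi K n) (Kn phi K n.+1).
Proof.
elim: n => [|n IH]//; rewrite /loewner_le.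
rewrite (_ : (fun s t => _) =
  pullback phi (fun s t => Kn phi K n.+1 s t - Kn phi K n s t)).
  exact: posdef_pullback IH.
by apply/funext => s; apply/funext => t; rewrite /pullback sumrB.
Qed.

Local Notation un := (un phi K).
Local Notation uoo := (uoo phi K).
Local Notation Xfin := (Xfin phi K).
Local Notation X2 := (X2 phi K).

Lemma un_nondecreasing s : {homo un ^~ s : n p / (n <= p)%N >-> (n <= p)%E}.
Proof.
apply/nondecreasing_seqP => n; rewrite lee_fin -subr_ge0 -ReB.
exact: posdef_diag_Re (Kn_nondecreasing n) _.
Qed.

(** The diagonal values increase by [K <= L K], so that the limit defining
    [uoo] exists in the extended reals and is a supremum. *)
Lemma uooE s : uoo s = ereal_sup (range (un ^~ s)).
Proof. exact/cvg_lim/ereal_nondecreasing_cvgn/un_nondecreasing. Qed.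

Lemma un_le_uoo n s : (un n s <= uoo s)%E.
Proof. by rewrite uooE; apply: ereal_sup_ubound; exists n. Qed.

Lemma uoo_ge0 s : (0 <= uoo s)%E.
Proof.
apply: le_trans (un_le_uoo 0 s); rewrite lee_fin.
exact: posdef_diag_Re K_posdef _.
Qed.

(** [un n.+1 s] is a sum of nonnegative terms, [un n (phi k s)] among them. *)
Lemma uoo_phi k s : (uoo (phi k s) <= uoo s)%E.
Proof.
rewrite [leLHS]uooE; apply: ub_ereal_sup => _ [n _ <-].
apply: le_trans (un_le_uoo n.+1 s).
rewrite lee_fin Re_sum (bigD1 k)//= lerDl sumr_ge0// => i _.
exact: posdef_diag_Re (Kn_posdef n) _.
Qed.

Lemma Xfin_phi k s : Xfin s -> Xfin (phi k s).
Proof. by move=> ?; apply: le_lt_trans (uoo_phi k s) _. Qed.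

Lemma Xfin_phiw w s : Xfin s -> Xfin (phiw phi w s).
Proof. by elim: w s => //= k w IH s /(Xfin_phi k); exact: IH. Qed.

Lemma cvg_Kn_diag s : Xfin s -> cvgn (fun n => complex.Re (Kn phi K n s s)).
Proof.
move=> fs; apply: nondecreasing_is_cvgn.
  by move=> n p np; rewrite -lee_fin; exact: un_nondecreasing.
exists (fine (uoo s)) => _ [n _ <-]; rewrite -lee_fin fineK ?un_le_uoo//.
by rewrite ge0_fin_numE ?uoo_ge0.
Qed.

(** Off the diagonal the entries need not be monotone, but adding the diagonal makes
    it so: the increments of [Kn] are positive definite, hence
    [2 * Re (Kn n s t)] plus the two diagonal values is nondecreasing, and
    bounded because the diagonals converge. Likewise for the imaginary part. *)
Lemma cvg_Kn s t : Xfin s -> Xfin t ->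
  (Kn phi K n s t : R[i]^o) @[n --> \oo] --> (Koo phi K s t : R[i]^o).
Proof.
move=> fs ft.
pose d n := complex.Re (Kn phi K n s s) + complex.Re (Kn phi K n t t).
have cd : cvgn d by apply: is_cvgD; exact: cvg_Kn_diag.
(* [p] is either the real or the imaginary part. *)
have part (p : R[i] -> R) : (forall z z', p (z - z') = p z - p z') ->
    (forall J, posdef setT J -> 2 * `|p (J s t)| <=
       complex.Re (J s s) + complex.Re (J t t)) ->
    cvgn (fun n => p (Kn phi K n s t)).
  move=> pB pd.
  pose r n := d n + 2 * p (Kn phi K n s t).
  have cr : cvgn r.
    apply: nondecreasing_is_cvgn.
      apply/nondecreasing_seqP => n; rewrite -subr_ge0.
      have := pd _ (Kn_nondecreasing n); rewrite !ReB pB /r /d.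
      by have := ler_norm (- (p (Kn phi K n.+1 s t) - p (Kn phi K n s t)));
         rewrite normrN; lra.
    have /cvg_has_ub [M Mub] := cd.
    exists (2 * M) => _ [n _ <-].
    have := Mub `|d n| (ex_intro2 _ _ n I erefl).
    have := pd _ (Kn_posdef n); rewrite -/(d n) /r.
    have := ler_norm (p (Kn phi K n s t)); have := ler_norm (d n); lra.
  rewrite (_ : (fun n => _) = (fun n => 2^-1 * (r n - d n))).
    by apply: is_cvgMl_tmp; exact: is_cvgB.
  by apply/funext => n; rewrite /r; lra.
have := part (@complex.Re R) (@ReB R) (fun J Jp => (posdef_dominated Jp I I).1).
have := part (@complex.Im R) (@ImB R) (fun J Jp => (posdef_dominated Jp I I).2).
move=> /cvg_ex[b cb] /cvg_ex[a ca].
by apply/cvg_ex; exists (Complex a b); exact: cvg_Complex.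
Qed.

Lemma Koo_posdef : posdef Xfin (Koo phi K).
Proof.
apply: (@posdef_lim _ _ _ (Kn phi K)) => [n|]; last exact: cvg_Kn.
exact: posdefS (Kn_posdef n).
Qed.

(** The words of length [n] starting from [phi k s] are the words of length
    [n.+1] starting from [s] whose first letter is [k]. *)
Lemma X2_phi k s : X2 s -> X2 (phi k s).
Proof.
move=> [fs Bs]; split; first exact: Xfin_phi.
apply: le_lt_trans Bs; apply: ub_ereal_sup => _ [n _ <-].
apply: (@le_trans _ _ ((m.+1 ^ n.+1)%:R%:E *
    \sum_(w : n.+1.-tuple 'I_m.+1) uoo (phiw phi w s) ^+ 2)%E); last first.
  by apply: ereal_sup_ubound; exists n.+1.
have sq0 x : (0 <= uoo x ^+ 2)%E by exact/expe_ge0/uoo_ge0.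
apply: lee_pmul => //.
- by apply: sume_ge0.
- by rewrite lee_fin ler_nat leq_pexp2l.
rewrite (@big_tuple_cons _ _ _ +%E _ (fun w => uoo (phiw phi w s) ^+ 2)%E).
rewrite (bigD1 k)//.
by apply: leeDl; apply: sume_ge0 => i _; apply: sume_ge0 => w _; exact: sq0.
Qed.

End KernelLimit.

(** * The path space: resampling the first letter *)

Section PathSpace.
Variable m : nat.
Local Notation Omega := (Defs.Omega m).
Implicit Types (C : nat -> set 'I_m.+1).

Lemma measurable_coord i (C : set 'I_m.+1) :
  measurable [set w : Omega | C (w i)].
Proof. by apply: sub_sigma_algebra; exists i, C. Qed.

Lemma measurable_path (F : Omega -> Omega) :
  (forall i (C : set 'I_m.+1), measurable [set w | C (F w i)]) ->
  measurable_fun [set: Omega] F.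
Proof.
move=> mF; apply: (@measurability _ _ Omega Omega setT F (@cylinders m) erefl).
by move=> _ [_ [i [C ->]] <-]; rewrite setTI; exact: mF.
Qed.

Lemma measurable_path_shift : measurable_fun [set: Omega] (@path_shift m).
Proof. by apply: measurable_path => i C; exact: measurable_coord. Qed.

Lemma measurable_iter_shift n :
  measurable_fun [set: Omega] (iter n (@path_shift m)).
Proof.
elim: n => [|n IH]; first exact: measurable_id.
exact: measurableT_comp measurable_path_shift IH.
Qed.

Definition path_cons (k : 'I_m.+1) (w : Omega) : Omega :=
  fun n => if n is n'.+1 then w n' else k.

Lemma measurable_path_cons k : measurable_fun [set: Omega] (path_cons k).
Proof.
apply: measurable_path => -[|i] C /=; last exact: measurable_coord.
by case: (pselect (C k)) => Ck; [rewrite (_ : mkset _ = setT)|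
  rewrite (_ : mkset _ = set0)]; rewrite ?predeqE//; exact: measurable0.
Qed.

HB.instance Definition _ k :=
  isMeasurableFun.Build _ _ _ _ (path_cons k) (measurable_path_cons k).

(** Finite-dimensional boxes form a pi-system, contrary to the cylinders over a
    single coordinate; independence computes their measure. *)
Definition box n C : set Omega := [set w | forall i, (i < n)%N -> C i (w i)].

Definition boxes : set (set Omega) := [set A | exists n C, A = box n C].

Lemma measurable_box n C : measurable (box n C).
Proof.
rewrite (_ : box n C = \bigcap_(i in [set i | (i < n)%N]) [set w | C i (w i)]).
  by apply: bigcap_measurableType => i _; exact: measurable_coord.
by apply/seteqP; split => w.
Qed.

Lemma measurable_boxesE : @measurable _ Omega = <<s boxes >>.
Proof.
apply/seteqP; split.
  apply: smallest_sub; first exact: smallest_sigma_algebra.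
  move=> _ [i [C ->]]; apply: sub_sigma_algebra.
  exists i.+1, (fun j => if j == i then C else setT).
  apply/seteqP; split => w /=.
    by move=> Cw j _; case: eqP => // ->.
  by move/(_ i (ltnSn i)); rewrite eqxx.
apply: smallest_sub; first exact: sigma_algebra_measurable.
by move=> _ [n [C ->]]; exact: measurable_box.
Qed.

Lemma boxes_setI : setI_closed boxes.
Proof.
move=> _ _ [n [C ->]] [p [D ->]].
exists (maxn n p).
exists (fun i => [set k | ((i < n)%N -> C i k) /\ ((i < p)%N -> D i k)]).
apply/seteqP; split => w /=.
  by move=> [Cw Dw] i _; split=> ?; [exact: Cw|exact: Dw].
move=> CDw; split => i ip; first by apply: (CDw i _).1; rewrite // leq_max ip.
by apply: (CDw i _).2; rewrite // leq_max ip orbT.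
Qed.

Variables (R : realType) (mu : probability Omega R).
Hypothesis mu_uniform : uniform_coordinates mu.
Hypothesis mu_indep : independent_coordinates mu.

Let uniform_prob (C : set 'I_m.+1) : R := \sum_(k < m.+1) \1_C k / m.+1%:R.

Lemma mu_coord i (C : set 'I_m.+1) : mu [set w | C (w i)] = (uniform_prob C)%:E.
Proof.
have -> : [set w | C (w i)] =
    \big[setU/set0]_(k < m.+1 | k \in C) [set w : Omega | w i = k].
  rewrite -bigcup_seq_cond; apply/seteqP; split => w /=.
    by move=> Cw; exists (w i) => //=; rewrite mem_index_enum inE.
  by move=> [k /= /andP[_ /set_mem Ck] ->].
rewrite measure_bigsetU_ord.
- rewrite /uniform_prob -sumEFin [LHS]big_mkcond/=; apply: eq_bigr => k _.
  by rewrite indicE; case: ifP => _; rewrite ?mul1r ?mul0r// mu_uniform.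
- by move=> k; exact: (measurable_coord i [set k]).
- by apply/trivIsetP => k l _ _ kl; apply/seteqP; split => // w [/= -> /eqP];
    rewrite (negPf kl).
Qed.

Lemma mu_box n C : mu (box n C) = (\prod_(i < n) uniform_prob (C i))%:E.
Proof.
pose I : {fset nat} := seq_fset tt (iota 0 n).
have := mu_indep I C.
rewrite (_ : [set w | _] = box n C); last first.
  apply/seteqP; split => w Cw i; have := Cw i;
  by rewrite seq_fsetE mem_iota.
move=> ->; rewrite -prodEFin.
rewrite (perm_big (iota 0 n)); last first.
  by rewrite (perm_trans (seq_fset_perm _ _))// undup_id ?iota_uniq.
rewrite -[X in iota 0 X]subn0 -/(index_iota 0 n) big_mkord.
by apply: eq_bigr => i _; exact: mu_coord.
Qed.

(** The first letter is uniform and independent of the shifted path, whose law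
    is again [mu]: putting a uniform random letter in front of a [mu]-random
    path yields a [mu]-random path. Both sides are finite measures in [A], so it
    suffices to compare them on boxes. *)
Lemma path_measureE A : measurable A ->
  (m.+1%:R%:E * mu A = \sum_(k < m.+1) mu (path_cons k @^-1` A))%E.
Proof.
move=> mA.
pose m1 : {measure set Omega -> \bar R} := mscale (NngNum (ler0n R m.+1)) mu.
pose m2 : {measure set Omega -> \bar R} :=
  msum (fun k => distribution mu (path_cons (inord k))) m.+1.
have m2E B : m2 B = (\sum_(k < m.+1) mu (path_cons k @^-1` B))%E.
  by apply: eq_bigr => k _; rewrite /distribution /pushforward/= inord_val.
rewrite -m2E -/(m1 A).
apply: (@measure_unique _ R Omega boxes (fun=> setT) _ _ _ _ m1 m2) => //.
- exact: measurable_boxesE.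
- exact: boxes_setI.
- by move=> _; exists 0%N, (fun=> setT); apply/seteqP; split.
- by apply/seteqP; split => // w _; exists 0%N.
- move=> _ [n [C ->]]; rewrite m2E /m1/= /mscale/=.
  case: n => [|n].
    rewrite mu_box big_ord0 mule1.
    have B0 k : path_cons k @^-1` box 0 C = setT by apply/seteqP; split.
    under eq_bigr do rewrite B0 probability_setT.
    by rewrite sumEFin sumr_const card_ord.
  have Bk k : mu (path_cons k @^-1` box n.+1 C) =
      (\1_(C 0%N) k * \prod_(i < n) uniform_prob (C i.+1))%:E.
    rewrite indicE; case: (boolP (k \in _)) => [/set_mem|/negP] Ck.
      rewrite mul1r -(mu_box n (fun i => C i.+1)); congr (mu _).
      apply/seteqP; split => w Bw i.
        by move=> ?; exact: (Bw i.+1).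
      by case: i => [|i]//= ?; exact: Bw.
    rewrite mul0r (_ : _ @^-1` _ = set0) ?measure0//.
    by apply/seteqP; split => // w /(_ 0%N isT); move/mem_set.
  under [RHS]eq_bigr do rewrite Bk.
  rewrite mu_box big_ord_recl/= sumEFin -EFinM; congr EFin.
  rewrite -mulr_suml mulrA /uniform_prob -mulr_suml mulrCA.
  by rewrite divff ?mulr1// pnatr_eq0.
- by move=> _; rewrite /m1/= /mscale/= probability_setT mule1 ltry.
Qed.

End PathSpace.

Section PathIntegral.
Variables (m : nat) (R : realType) (mu : probability (Omega m) R).
Hypothesis mu_uniform : uniform_coordinates mu.
Hypothesis mu_indep : independent_coordinates mu.

Lemma ge0_integral_path_cons (F : Omega m -> \bar R) :
  (forall w, 0 <= F w)%E -> measurable_fun [set: Omega m] F ->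
  (m.+1%:R%:E * \int[mu]_w F w =
   \sum_(k < m.+1) \int[mu]_w F (path_cons k w))%E.
Proof.
move=> F0 mF.
pose m2 : {measure set (Omega m) -> \bar R} :=
  msum (fun k => distribution mu (path_cons (inord k))) m.+1.
have := ge0_integral_mscale mu measurableT (NngNum (ler0n R m.+1)) mF
  (fun w _ => F0 w).
move=> /= <-; rewrite (eq_measure_integral m2); last first.
  move=> A mA _; rewrite /= /mscale/= path_measureE//.
  by apply: eq_bigr => k _; rewrite /distribution /pushforward/= inord_val.
rewrite ge0_integral_measure_sum//; apply: eq_bigr => k _ /=.
by rewrite inord_val ge0_integral_pushforward//; exact: measurable_path_cons.
Qed.

(** Prepending a letter multiplies the measure of a preimage by at most
    [m.+1], hence preserves null sets. *)
Lemma ae_path_cons k (P : Omega m -> Prop) :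
  {ae mu, forall w, P w} -> {ae mu, forall w, P (path_cons k w)}.
Proof.
move=> [N [mN N0 PN]]; exists (path_cons k @^-1` N); split.
- by rewrite -[X in measurable X]setTI; exact: measurable_path_cons.
- have := path_measureE mu_uniform mu_indep mN.
  rewrite N0 mule0 (bigD1 k)//= => E.
  by apply/eqP; rewrite eq_le measure_ge0 andbT [leRHS]E leeDl// sume_ge0.
- by move=> w /= Pw; exact: PN.
Qed.

Lemma integrable_path_cons k (F : Omega m -> \bar R) :
  mu.-integrable [set: Omega m] F ->
  mu.-integrable [set: Omega m] (F \o path_cons k).
Proof.
move=> /integrableP[mF iF]; apply/integrableP; split.
  by apply: measurableT_comp mF _; exact: measurable_path_cons.
have mF' : measurable_fun [set: Omega m] (abse \o F).
  exact: measurableT_comp.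
have := ge0_integral_path_cons (fun w => abse_ge0 (F w)) mF'.
rewrite (bigD1 k)//= => E.
apply: (@le_lt_trans _ _ (m.+1%:R%:E * \int[mu]_w `|F w|)%E).
  by rewrite E leeDl// sume_ge0// => i _; exact: integral_ge0.
by rewrite lte_mul_pinfty// ge0_fin_numE// integral_ge0.
Qed.

Lemma Rintegral_path_cons (F : Omega m -> R) :
  mu.-integrable [set: Omega m] (EFin \o F) ->
  m.+1%:R * \int[mu]_w F w = \sum_(k < m.+1) \int[mu]_w F (path_cons k w).
Proof.
(* [F] is the difference of the nonnegative functions [`|F| + F] and [`|F|]. *)
have H0 (G : Omega m -> R) : (forall w, 0 <= G w) ->
    mu.-integrable [set: Omega m] (EFin \o G) ->
    m.+1%:R * \int[mu]_w G w = \sum_(k < m.+1) \int[mu]_w G (path_cons k w).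
  move=> G0 iG; apply: EFin_inj.
  rewrite -sumEFin EFinM fineK ?integrable_fin_num//.
  rewrite ge0_integral_path_cons; last exact: (measurable_int _ iG).
    apply: eq_bigr => k _; rewrite fineK//.
    by apply: integrable_fin_num => //; exact: integrable_path_cons iG.
  by move=> w; rewrite lee_fin.
move=> iF.
have iA : mu.-integrable setT (EFin \o (fun w => `|F w|)).
  exact: integrable_abse iF.
have iD : mu.-integrable setT (EFin \o (fun w => `|F w| + F w)).
  exact: integrableD iA iF.
have FE w : F w = (`|F w| + F w) - `|F w| by rewrite addrC addKr.
rewrite (eq_Rintegral _ (fun w _ => FE w)) RintegralB//.
rewrite mulrBr !H0//; last first.
  by move=> w; rewrite -lerBlDl sub0r lerNl -normrN ler_norm.
rewrite -sumrB; apply: eq_bigr => k _.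
rewrite -RintegralB//; first by apply: eq_Rintegral => w _ /=; rewrite -FE.
  exact: integrable_path_cons iD.
exact: integrable_path_cons iA.
Qed.

End PathIntegral.

(** * Complex-valued integrals *)

Section ComplexIntegral.
Variables (d : measure_display) (T : measurableType d) (R : realType).
Variable mu : {measure set T -> \bar R}.
Implicit Types F G : T -> R[i].

Definition cint F : R[i] :=
  Complex (\int[mu]_x complex.Re (F x)) (\int[mu]_x complex.Im (F x)).

Definition cintegrable F : Prop :=
  mu.-integrable [set: T] (fun x => (complex.Re (F x))%:E) /\
  mu.-integrable [set: T] (fun x => (complex.Im (F x))%:E).

Let integrable_lin (a b : R) (u v : T -> R) :
  mu.-integrable [set: T] (EFin \o u) -> mu.-integrable [set: T] (EFin \o v) ->
  mu.-integrable [set: T] (EFin \o (fun x => a * u x + b * v x)).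
Proof.
move=> iu iv.
have := @integrableD _ _ _ mu _ measurableT (fun x => a%:E * (u x)%:E)%E
  (fun x => b%:E * (v x)%:E)%E (integrableZl measurableT a iu)
  (integrableZl measurableT b iv).
by apply: eq_integrable.
Qed.

Let Rintegral_lin (a b : R) (u v : T -> R) :
  mu.-integrable [set: T] (EFin \o u) -> mu.-integrable [set: T] (EFin \o v) ->
  \int[mu]_x (a * u x + b * v x) = a * \int[mu]_x u x + b * \int[mu]_x v x.
Proof.
move=> iu iv; rewrite RintegralD//; first by rewrite !RintegralZl.
- exact: (integrableZl measurableT a iu).
- exact: (integrableZl measurableT b iv).
Qed.

Lemma cintegrableZ (c : R[i]) F :
  cintegrable F -> cintegrable (fun x => c * F x).
Proof.
move=> [iR iI]; split.
  apply: eq_integrable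
    (integrable_lin (complex.Re c) (- complex.Im c) iR iI) => //.
  by move=> x _; rewrite /= ReM mulNr.
apply: eq_integrable (integrable_lin (complex.Re c) (complex.Im c) iI iR) => //.
by move=> x _; rewrite /= ImM.
Qed.

Lemma cintZ (c : R[i]) F :
  cintegrable F -> cint (fun x => c * F x) = c * cint F.
Proof.
move=> [iR iI]; apply/eqP; rewrite eq_complex ReM ImM /=.
under eq_Rintegral do rewrite ReM -mulNr.
under [X in _ && (X == _)]eq_Rintegral do rewrite ImM.
by rewrite !Rintegral_lin// mulNr !eqxx.
Qed.

Lemma cintegrableD F G : cintegrable F -> cintegrable G ->
  cintegrable (fun x => F x + G x).
Proof.
move=> [FR FI] [GR GI]; split.
  apply: eq_integrable (integrable_lin 1 1 FR GR) => // x _ /=.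
  by rewrite !mul1r; case: (F x) (G x) => [? ?] [? ?].
apply: eq_integrable (integrable_lin 1 1 FI GI) => // x _ /=.
by rewrite !mul1r; case: (F x) (G x) => [? ?] [? ?].
Qed.

Lemma cintD F G : cintegrable F -> cintegrable G ->
  cint (fun x => F x + G x) = cint F + cint G.
Proof.
move=> [FR FI] [GR GI]; rewrite {2 3}/cint; apply/eqP; rewrite eq_complex /=.
rewrite -!RintegralD//.
apply/andP; split; apply/eqP; apply: eq_Rintegral => x _.
  by case: (F x) (G x) => [? ?] [? ?].
by case: (F x) (G x) => [? ?] [? ?].
Qed.

Lemma cint0 : cint (fun=> 0) = 0.
Proof. by apply/eqP; rewrite eq_complex/= /Rintegral !integral0 !eqxx. Qed.

Lemma cintegrable0 : cintegrable (fun=> 0).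
Proof. by split; exact: integrable0. Qed.

Lemma cintegrable_sum I (r : seq I) (F : I -> T -> R[i]) :
  (forall i, cintegrable (F i)) -> cintegrable (fun x => \sum_(i <- r) F i x).
Proof.
move=> iF; elim: r => [|i r IH].
  by under eq_fun do rewrite big_nil; exact: cintegrable0.
by under eq_fun do rewrite big_cons; exact: cintegrableD.
Qed.

Lemma cint_sum I (r : seq I) (F : I -> T -> R[i]) :
  (forall i, cintegrable (F i)) ->
  cint (fun x => \sum_(i <- r) F i x) = \sum_(i <- r) cint (F i).
Proof.
move=> iF; elim: r => [|i r IH].
  by under eq_fun do rewrite big_nil; rewrite big_nil cint0.
under eq_fun do rewrite big_cons.
by rewrite cintD ?IH ?big_cons//; exact: cintegrable_sum.
Qed.

Let ae_eq_Rint (u v : T -> R) : measurable_fun [set: T] u ->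
  measurable_fun [set: T] v -> {ae mu, forall x, u x = v x} ->
  \int[mu]_x u x = \int[mu]_x v x.
Proof.
move=> mu' mv uv; congr fine; apply: ae_eq_integral => //.
- exact/measurable_EFinP.
- exact/measurable_EFinP.
- by apply: filterS uv => x -> _.
Qed.

Lemma cintegrable_measurable F : cintegrable F ->
  measurable_fun [set: T] (fun x => complex.Re (F x)) /\
  measurable_fun [set: T] (fun x => complex.Im (F x)).
Proof.
by move=> [/measurable_int/measurable_EFinP ? /measurable_int/measurable_EFinP].
Qed.

Lemma ae_eq_cint F G : cintegrable F -> cintegrable G ->
  {ae mu, forall x, F x = G x} -> cint F = cint G.
Proof.
move=> /cintegrable_measurable[? ?] /cintegrable_measurable[? ?] FG.
by congr Complex; apply: ae_eq_Rint => //; apply: filterS FG => x ->.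
Qed.

Lemma cint_ge0 F : cintegrable F -> {ae mu, forall x, 0 <= F x} -> 0 <= cint F.
Proof.
move=> /cintegrable_measurable[mR mI] F0; rewrite complex_ge0.
apply/andP; split.
  rewrite /= (@ae_eq_Rint _ (fun=> 0))//; first by rewrite /Rintegral integral0.
  by apply: filterS F0 => x; rewrite complex_ge0 => /andP[/eqP].
rewrite /= (@ae_eq_Rint _ (fun x => `|complex.Re (F x)|)).
- by apply: Rintegral_ge0.
- by [].
- exact: measurableT_comp.
- apply: filterS F0 => x; rewrite complex_ge0 => /andP[_ ?].
  by rewrite ger0_norm.
Qed.

End ComplexIntegral.

Section ComplexPathIntegral.
Variables (m : nat) (R : realType) (mu : probability (Omega m) R).
Hypothesis mu_uniform : uniform_coordinates mu.
Hypothesis mu_indep : independent_coordinates mu.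

Lemma cintegrable_path_cons k (F : Omega m -> R[i]) :
  cintegrable mu F -> cintegrable mu (F \o path_cons k).
Proof.
move=> [iR iI]; split; first exact: (integrable_path_cons _ _ _ iR).
exact: (integrable_path_cons _ _ _ iI).
Qed.

Lemma cint_path_cons (F : Omega m -> R[i]) : cintegrable mu F ->
  m.+1%:R * cint mu F = \sum_(k < m.+1) cint mu (F \o path_cons k).
Proof.
move=> [iR iI]; apply/eqP; rewrite eq_complex Re_sum Im_sum ReM ImM /=.
rewrite -(rmorph_nat (real_complex R))/= !mul0r subr0 addr0.
by rewrite !(Rintegral_path_cons mu_uniform mu_indep)// !eqxx.
Qed.

End ComplexPathIntegral.

(** * The martingale limit and the weighted kernels *)

Section WeightedKernels.
Variables (R : realType) (X : Type) (m : nat) (phi : 'I_m.+1 -> X -> X).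
Variable K : X -> X -> R[i].
Hypothesis K_posdef : posdef [set: X] K.
Hypothesis K_le_LK : loewner_le [set: X] K (pullback phi K).
Variable mu : probability (Omega m) R.
Hypothesis mu_uniform : uniform_coordinates mu.
Hypothesis mu_indep : independent_coordinates mu.
Variable Moo : X -> X -> Omega m -> R[i].
Hypothesis Moo_limit : is_martingale_limit phi K mu Moo.

Local Notation X2 := (X2 phi K).
Local Notation h := (hdiag Moo).

Lemma Mn_posdef n w : posdef X2 (fun s t => Mn phi K n s t w).
Proof.
apply: posdefZ; first exact: ler0n.
pose p := phiw phi (prefix_word w n).
have pX2 s : X2 s -> Xfin phi K (p s) by move=> [fs _]; exact: Xfin_phiw.
exact: (posdef_comp pX2 (Koo_posdef K_posdef K_le_LK)).
Qed.

Lemma Mn_cvg s t : X2 s -> X2 t ->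
  {ae mu, forall w, (Mn phi K n s t w : R[i]^o) @[n --> \oo]
                      --> (Moo s t w : R[i]^o)}.
Proof. by move=> Xs Xt; have [] := Moo_limit.1 s t Xs Xt. Qed.

(** At a fixed path each [Mn n] is a rescaled pullback of [Koo], hence positive
    definite, and this passes to the almost sure limit. The exceptional null set
    depends on the finite family: the space [X] may be uncountable. *)
Lemma Moo_posdef n (s : 'I_n -> X) : (forall a, X2 (s a)) ->
  {ae mu, forall w, posdef (range s) (fun x y => Moo x y w)}.
Proof.
move=> Xs.
have : {ae mu, forall w, forall a b,
    (Mn phi K n (s a) (s b) w : R[i]^o) @[n --> \oo]
      --> (Moo (s a) (s b) w : R[i]^o)}.
  by apply: filter_forall => a; apply: filter_forall => b; exact: Mn_cvg.
apply: filterS => w cw.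
apply: (@posdef_lim _ _ _ (fun n x y => Mn phi K n x y w)).
  by move=> k; apply: posdefS (Mn_posdef k w) => _ [a _ <-].
by move=> _ _ [a _ <-] [b _ <-].
Qed.

Lemma Moo_dominated s t : X2 s -> X2 t ->
  {ae mu, forall w, 2 * `|complex.Re (Moo s t w)| <= h s w + h t w /\
                    2 * `|complex.Im (Moo s t w)| <= h s w + h t w}.
Proof.
move=> Xs Xt.
have := @Moo_posdef 2 (fun i => if i == ord0 then s else t).
have Xst (a : 'I_2) : X2 (if a == ord0 then s else t) by case: ifP.
move=> /(_ Xst).
apply: filterS => w pd; apply: (posdef_dominated pd); first by exists ord0.
by exists ord_max.
Qed.

Lemma Mn_path_cons n k s t w :
  Mn phi K n.+1 s t (path_cons k w) =
  m.+1%:R * Mn phi K n (phi k s) (phi k t) w.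
Proof.
rewrite /Mn mulrA -natrM -expnS.
suff -> : prefix_word (path_cons k w) n.+1 = k :: prefix_word w n by [].
by rewrite /prefix_word /mkseq /= -[1%N]addn0 iotaDl -map_comp.
Qed.

(** The limit inherits the one-step recursion of the martingale, almost surely
    and by uniqueness of limits. *)
Lemma Moo_path_cons k s t : X2 s -> X2 t ->
  {ae mu, forall w, Moo s t (path_cons k w) =
                    m.+1%:R * Moo (phi k s) (phi k t) w}.
Proof.
move=> Xs Xt.
have X2k := @X2_phi _ _ _ _ _ K_posdef K_le_LK k.
have := ae_path_cons mu_uniform mu_indep k (Mn_cvg Xs Xt).
apply: filterS2 (Mn_cvg (X2k _ Xs) (X2k _ Xt)) => w c1.
rewrite -cvg_shiftS; under eq_fun do rewrite Mn_path_cons.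
move=> c2; apply: cvg_unique c2 _; first exact: norm_hausdorff.
exact: cvgMl_tmp.
Qed.

Lemma hdiag_ge0 s w : X2 s -> 0 <= h s w.
Proof. by move=> /Moo_limit.2/(_ w); rewrite complex_ge0 => /andP[]. Qed.

Lemma Re_Moo_measurable s t : X2 s -> X2 t ->
  measurable_fun [set: Omega m] (fun w => complex.Re (Moo s t w)).
Proof. by move=> Xs Xt; have [[]] := Moo_limit.1 s t Xs Xt. Qed.

Lemma Im_Moo_measurable s t : X2 s -> X2 t ->
  measurable_fun [set: Omega m] (fun w => complex.Im (Moo s t w)).
Proof. by move=> Xs Xt; have [[]] := Moo_limit.1 s t Xs Xt. Qed.

Lemma hdiag_measurable s : X2 s -> measurable_fun [set: Omega m] (h s).
Proof. by move=> Xs; exact: Re_Moo_measurable. Qed.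

Section Weight.
Variable g : Omega m -> \bar R.
Hypothesis g_ge0 : forall w, (0 <= g w)%E.
Hypothesis g_meas : measurable_fun [set: Omega m] g.

Local Notation Xg := (Xw phi K mu Moo g).
Local Notation Jg := (Jw mu Moo g).

Lemma gh_ge0 s w : X2 s -> (0 <= g w * (h s w)%:E)%E.
Proof. by move=> Xs; rewrite mule_ge0// lee_fin hdiag_ge0. Qed.

Lemma gh_measurable s : X2 s ->
  measurable_fun [set: Omega m] (fun w => g w * (h s w)%:E)%E.
Proof.
move=> Xs; apply: emeasurable_funM => //.
by apply/measurable_EFinP; exact: hdiag_measurable.
Qed.

Lemma gh_integrable s : Xg s ->
  mu.-integrable [set: Omega m] (fun w => g w * (h s w)%:E)%E.
Proof.
move=> [Xs fs]; apply/integrableP; split; first exact: gh_measurable.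
by under eq_integral do rewrite gee0_abs ?gh_ge0//.
Qed.

(** Integrability of [g * h s] forces [h s] to vanish where [g] is infinite, and
    then so do all entries of the kernel. This is what makes it harmless to
    replace [g] by the real-valued [fine \o g], which is [0] there. *)
Lemma hdiag_eq0 s : Xg s -> {ae mu, forall w, g w = +oo%E -> h s w = 0}.
Proof.
move=> Xgs; have [Xs _] := Xgs.
apply: filterS (integrable_ae measurableT (gh_integrable Xgs)) => w /(_ I).
move=> + gw; rewrite gw; have := hdiag_ge0 w Xs; rewrite le_eqVlt.
by case/predU1P => [<-//|h0]; rewrite gt0_mulye ?lte_fin.
Qed.

Lemma Moo_eq0 s t : Xg s -> Xg t ->
  {ae mu, forall w, g w = +oo%E -> Moo s t w = 0}.
Proof.
move=> Xgs Xgt.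
apply: filterS3 (Moo_dominated Xgs.1 Xgt.1) (hdiag_eq0 Xgs) (hdiag_eq0 Xgt).
move=> w [dR dI] hs ht gw; apply/eqP; rewrite eq_complex/=.
move: dR dI; rewrite hs// ht// addr0 !pmulr_rle0// !normr_le0.
by move=> /eqP-> /eqP->; rewrite !eqxx.
Qed.

(** [p] is the real or the imaginary part; both are dominated by the integrable
    function [g * (h s + h t)]. *)
Let component s t (p : R[i] -> R) : Xg s -> Xg t -> p 0 = 0 ->
  measurable_fun [set: Omega m] (fun w => p (Moo s t w)) ->
  {ae mu, forall w, 2 * `|p (Moo s t w)| <= h s w + h t w} ->
  mu.-integrable [set: Omega m] (fun w => (fine (g w) * p (Moo s t w))%:E) /\
  fine (\int[mu]_w (g w * (p (Moo s t w))%:E)) =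
    \int[mu]_w (fine (g w) * p (Moo s t w)).
Proof.
move=> Xgs Xgt p0 mp dp; have [[Xs _] [Xt _]] := (Xgs, Xgt).
have mgM : measurable_fun [set: Omega m] (fun w => g w * (p (Moo s t w))%:E)%E.
  by apply: emeasurable_funM => //; exact/measurable_EFinP.
have mfM : measurable_fun [set: Omega m] (fun w => fine (g w) * p (Moo s t w)).
  by apply: measurable_funM => //; exact: measurableT_comp.
have E : {ae mu, forall w, (g w * (p (Moo s t w))%:E)%E =
                           (fine (g w) * p (Moo s t w))%:E}.
  apply: filterS (Moo_eq0 Xgs Xgt) => w Mw.
  move: (g_ge0 w) Mw; case: (g w) => [r|+ ->|]//=.
  by rewrite p0 mulr0 mule0.
split; last first.
  congr fine; apply: ae_eq_integral => //; first exact/measurable_EFinP.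
  by apply: filterS E => w + _.
apply/integrableP; split; first exact/measurable_EFinP.
have igg := integrableD measurableT (gh_integrable Xgs) (gh_integrable Xgt).
have [mgg] := integrableP _ _ _ igg; apply: le_lt_trans.
apply: ae_ge0_le_integral => //.
- exact/measurableT_comp/measurable_EFinP.
- exact: measurableT_comp.
apply: filterS2 dp E => w dpw <- _.
rewrite [leRHS]gee0_abs; last by apply: adde_ge0; exact: gh_ge0.
rewrite abseM gee0_abs//= -ge0_muleDr ?lee_fin ?hdiag_ge0// -EFinD.
apply: lee_wpmul2l => //; rewrite lee_fin.
by have := normr_ge0 (p (Moo s t w)); lra.
Qed.

Lemma Jw_cint s t : Xg s -> Xg t ->
  cintegrable mu (fun w => (fine (g w))%:C%C * Moo s t w) /\
  Jg s t = cint mu (fun w => (fine (g w))%:C%C * Moo s t w).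
Proof.
move=> Xgs Xgt; have [[Xs _] [Xt _]] := (Xgs, Xgt).
have dom := Moo_dominated Xs Xt.
have [iR eR] := @component s t (@complex.Re R) Xgs Xgt erefl
  (Re_Moo_measurable Xs Xt) (filterS (fun w => @proj1 _ _) dom).
have [iI eI] := @component s t (@complex.Im R) Xgs Xgt erefl
  (Im_Moo_measurable Xs Xt) (filterS (fun w => @proj2 _ _) dom).
have ER w : complex.Re ((fine (g w))%:C%C * Moo s t w) =
    fine (g w) * complex.Re (Moo s t w) by rewrite ReM/= mul0r subr0.
have EI w : complex.Im ((fine (g w))%:C%C * Moo s t w) =
    fine (g w) * complex.Im (Moo s t w) by rewrite ImM/= mul0r addr0.
split; last first.
  by rewrite /Jw eR eI; congr Complex; apply: eq_Rintegral => w _.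
by split; [apply: eq_integrable iR|apply: eq_integrable iI] => // w _;
  rewrite ?ER ?EI.
Qed.

End Weight.

Lemma Xw_le (g1 g2 : Omega m -> \bar R) :
  measurable_fun [set: Omega m] g1 -> measurable_fun [set: Omega m] g2 ->
  (forall w, 0 <= g1 w)%E -> (forall w, g1 w <= g2 w)%E ->
  Xw phi K mu Moo g2 `<=` Xw phi K mu Moo g1.
Proof.
move=> m1 m2 g10 g12 s [Xs fs].
have g20 w : (0 <= g2 w)%E by exact: le_trans (g12 w).
split => //; apply: le_lt_trans fs.
apply: ge0_le_integral => //.
- by move=> w _; exact: gh_ge0.
- exact: gh_measurable.
- exact: gh_measurable.
- by move=> w _; rewrite lee_wpmul2r// lee_fin hdiag_ge0.
Qed.

(** [Jw g2 - Jw g1] is the integral of the almost surely positive definite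
    kernel [Moo] against [fine \o g2 - fine \o g1]. This difference is
    nonnegative where [g2] is finite; where [g2] is infinite it may be negative,
    but there the kernel vanishes almost surely. *)
Lemma Jw_le (g1 g2 : Omega m -> \bar R) :
  measurable_fun [set: Omega m] g1 -> measurable_fun [set: Omega m] g2 ->
  (forall w, 0 <= g1 w)%E -> (forall w, g1 w <= g2 w)%E ->
  loewner_le (Xw phi K mu Moo g2) (Jw mu Moo g1) (Jw mu Moo g2).
Proof.
move=> m1 m2 g10 g12 n c s Xs2.
have g20 w : (0 <= g2 w)%E by exact: le_trans (g12 w).
have Xs1 a := Xw_le m1 m2 g10 g12 (Xs2 a).
have J1 a b := Jw_cint g10 m1 (Xs1 a) (Xs1 b).
have J2 a b := Jw_cint g20 m2 (Xs2 a) (Xs2 b).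
(* Written with [-1 *] so that [cintD] and [cintZ] apply. *)
pose D a b w := (fine (g2 w))%:C%C * Moo (s a) (s b) w +
  (-1) * ((fine (g1 w))%:C%C * Moo (s a) (s b) w).
have iD a b : cintegrable mu (D a b).
  apply: cintegrableD; first exact: (J2 a b).1.
  exact/cintegrableZ/(J1 a b).1.
have JD a b : Jw mu Moo g2 (s a) (s b) - Jw mu Moo g1 (s a) (s b) =
    cint mu (D a b).
  rewrite cintD; [|exact: (J2 a b).1|exact/cintegrableZ/(J1 a b).1].
  by rewrite cintZ ?mulN1r -?(J2 a b).2 -?(J1 a b).2//; exact: (J1 a b).1.
under eq_bigr do under eq_bigr do rewrite JD -cintZ//.
under eq_bigr do (rewrite -cint_sum => [|i]; last exact: cintegrableZ).
have iS a : cintegrable mu (fun w => \sum_(b < n) (c a)^* * c b * D a b w).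
  by apply: cintegrable_sum => b; exact: cintegrableZ.
rewrite -cint_sum//; apply: cint_ge0; first exact: cintegrable_sum.
have z : {ae mu, forall w, forall a b, g2 w = +oo%E -> Moo (s a) (s b) w = 0}.
  by apply: filter_forall => a; apply: filter_forall => b; exact: Moo_eq0.
apply: filterS2 z (Moo_posdef (fun a => (Xs2 a).1)) => w zw pw.
have [goo|gfin] := eqVneq (g2 w) +oo%E.
  rewrite big1// => a _; rewrite big1// => b _.
  by rewrite /D zw// !mulr0 addr0 mulr0.
have -> : \sum_(a < n) \sum_(b < n) (c a)^* * c b * D a b w =
    (fine (g2 w) - fine (g1 w))%:C%C *
    \sum_(a < n) \sum_(b < n) (c a)^* * c b * Moo (s a) (s b) w.
  rewrite mulr_sumr; apply: eq_bigr => a _.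
  rewrite mulr_sumr; apply: eq_bigr => b _.
  by rewrite /D rmorphB/=; ring.
apply: mulr_ge0; last by apply: pw => a; exists a.
rewrite ler0c subr_ge0 fine_le//.
  by rewrite ge0_fin_numE// (le_lt_trans (g12 w))// ltey.
by rewrite ge0_fin_numE// ltey.
Qed.

Section Shift.
Variable g : Omega m -> \bar R.
Hypothesis g_ge0 : forall w, (0 <= g w)%E.
Hypothesis g_meas : measurable_fun [set: Omega m] g.

Local Notation gs := (g \o @path_shift m).

Let gs_meas : measurable_fun [set: Omega m] gs.
Proof. exact: (measurableT_comp g_meas (@measurable_path_shift m)). Qed.

Let gs_ge0 w : (0 <= gs w)%E. Proof. exact: g_ge0. Qed.

(** Conditioning on the first letter [k] turns [h s] into [m.+1 * h (phi k s)]
    and [g \o path_shift] into [g]: up to a factor, the integral of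
    [g * h (phi k s)] is one of the nonnegative terms that add up to that of
    [(g \o path_shift) * h s]. *)
Lemma Xw_phi k s : Xw phi K mu Moo gs s -> Xw phi K mu Moo g (phi k s).
Proof.
move=> [Xs fs]; have Xk := X2_phi K_posdef K_le_LK k Xs; split => //.
have mgs : measurable_fun setT (fun w => gs w * (h s w)%:E)%E.
  exact: gh_measurable.
have gs0 w : (0 <= gs w * (h s w)%:E)%E by exact: (gh_ge0 gs_ge0 w Xs).
have := ge0_integral_path_cons mu_uniform mu_indep gs0 mgs.
rewrite (bigD1 k)//= => E.
have : (\int[mu]_w (g w * (h s (path_cons k w))%:E) < +oo)%E.
  apply: (@le_lt_trans _ _ (m.+1%:R%:E * \int[mu]_w (gs w * (h s w)%:E))%E).
    rewrite E leeDl// sume_ge0// => i _; apply: integral_ge0 => w _.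
    exact: (gs0 (path_cons i w)).
  by rewrite lte_mul_pinfty// ge0_fin_numE// integral_ge0.
apply: le_lt_trans; apply: ae_ge0_le_integral => //.
- by move=> w _; exact: gh_ge0.
- exact: gh_measurable.
- by move=> w _; exact: (gs0 (path_cons k w)).
- exact: (measurableT_comp mgs (measurable_path_cons k)).
apply: filterS (Moo_path_cons k Xs Xs) => w Mk _.
apply: lee_wpmul2l => //; rewrite lee_fin /hdiag Mk.
rewrite -(rmorph_nat (real_complex R)) ReM/= mul0r subr0 ler_peMl ?hdiag_ge0//.
by rewrite ler1n.
Qed.

(** Shifting the weight amounts to applying the pullback operator: condition on
    the first letter; the factor [m.+1] of the martingale recursion cancels the
    probability of a letter. *)
Lemma Jw_shift s t : Xw phi K mu Moo gs s -> Xw phi K mu Moo gs t ->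
  Jw mu Moo gs s t = pullback phi (Jw mu Moo g) s t.
Proof.
move=> Xs Xt.
have [iJ ->] := Jw_cint gs_ge0 gs_meas Xs Xt.
have m0 : m.+1%:R != 0 :> R[i] by rewrite pnatr_eq0.
apply: (mulfI m0); rewrite cint_path_cons// /pullback mulr_sumr.
apply: eq_bigr => k _.
have [iJk ->] := Jw_cint g_ge0 g_meas (Xw_phi k Xs) (Xw_phi k Xt).
rewrite -cintZ//; apply: ae_eq_cint.
- exact: cintegrable_path_cons.
- exact: cintegrableZ.
apply: filterS (Moo_path_cons k Xs.1 Xt.1) => w /= ->.
by rewrite mulrCA.
Qed.

End Shift.

Lemma Jw_pullback_pow n (g : Omega m -> \bar R) s t :
  (forall w, 0 <= g w)%E -> measurable_fun [set: Omega m] g ->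
  Xw phi K mu Moo (g \o iter n (@path_shift m)) s ->
  Xw phi K mu Moo (g \o iter n (@path_shift m)) t ->
  Jw mu Moo (g \o iter n (@path_shift m)) s t =
    pullback_pow phi n (Jw mu Moo g) s t.
Proof.
move=> g0 mg; elim: n s t => [|n IH] s t.
  move=> _ _; rewrite /pullback_pow.
  rewrite (big_pred1 [tuple])//= => w.
  by apply/esym/eqP/tuple0.
set gn := g \o iter n (@path_shift m).
have -> : g \o iter n.+1 (@path_shift m) = gn \o @path_shift m.
  by apply/funext => w; rewrite /gn /= -iterSr.
have mgn : measurable_fun setT gn.
  exact: (measurableT_comp mg (@measurable_iter_shift m n)).
have gn0 w : (0 <= gn w)%E by exact: g0.
move=> Xs Xt; rewrite Jw_shift// pullback_powS; apply: eq_bigr => k _.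
by apply: IH; exact: Xw_phi.
Qed.

End WeightedKernels.

(** * The maximal function of the shift *)

Section MaximalFunction.
Variables (R : realType) (m : nat) (f : Omega m -> \bar R).

Lemma fstar_ge n w :
  (f (iter n (@path_shift m) w) <= fstar f w)%E.
Proof. by apply: ereal_sup_ubound; exists n. Qed.

Lemma fstar_shift w :
  (fstar f (path_shift w) <= fstar f w)%E.
Proof.
apply: ub_ereal_sup => _ [n _ <-]; rewrite -iterSr; exact: fstar_ge.
Qed.

Lemma fstar_measurable :
  measurable_fun [set: Omega m] f -> measurable_fun [set: Omega m] (fstar f).
Proof.
move=> mf.
have := @measurable_fun_esups _ _ R setT
  (fun n w => f (iter n (@path_shift m) w)) _ 0%N.
have -> : (fun w => esups (fun n => f (iter n (@path_shift m) w)) 0) = fstar f.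
  apply/funext => w; rewrite /esups /fstar; congr ereal_sup.
  by apply/seteqP; split => _ [n _ <-]; exists n.
by apply=> n; exact: (measurableT_comp mf (@measurable_iter_shift m n)).
Qed.

End MaximalFunction.

Theorem theorem7p6 (R : realType) (X : Type) (m : nat)
    (phi : 'I_m.+1 -> X -> X) (K : X -> X -> R[i])
    (K_posdef : posdef [set: X] K)
    (K_le_LK : loewner_le [set: X] K (pullback phi K))
    (mu : probability (Omega m) R)
    (mu_uniform : uniform_coordinates mu)
    (mu_indep : independent_coordinates mu)
    (Moo : X -> X -> Omega m -> R[i])
    (Moo_limit : is_martingale_limit phi K mu Moo)
    (f : Omega m -> \bar R)
    (f_ge0 : forall w, (0 <= f w)%E)
    (f_meas : measurable_fun [set: Omega m] f) :
  [/\ (forall w, (0 <= fstar f w)%E),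
      measurable_fun [set: Omega m] (fstar f),
      forall n : nat,
        Xw phi K mu Moo (fstar f)
          `<=` Xw phi K mu Moo (f \o iter n (@path_shift m)) /\
        loewner_le (Xw phi K mu Moo (fstar f))
          (pullback_pow phi n (Jw mu Moo f)) (Jw mu Moo (fstar f)) &
      loewner_le (Xw phi K mu Moo (fstar f))
        (pullback phi (Jw mu Moo (fstar f))) (Jw mu Moo (fstar f))].
Proof.
have fs_meas := fstar_measurable f_meas.
have fs_ge0 w : (0 <= fstar f w)%E.
  exact: le_trans (f_ge0 w) (fstar_ge f 0 w).
split=> // [n|].
  have fn_meas := measurableT_comp f_meas (@measurable_iter_shift m n).
  have fn_ge0 w : (0 <= f (iter n (@path_shift m) w))%E by exact: f_ge0.
  have fn_le w := fstar_ge f n w.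
  have sub := Xw_le Moo_limit fn_meas fs_meas fn_ge0 fn_le.
  split => // k c s Xs.
  have := Jw_le K_posdef K_le_LK Moo_limit fn_meas fs_meas fn_ge0 fn_le c Xs.
  have Jn a b := Jw_pullback_pow K_posdef K_le_LK mu_uniform mu_indep Moo_limit
    f_ge0 f_meas (sub _ (Xs a)) (sub _ (Xs b)).
  by under eq_bigr do under eq_bigr do rewrite Jn.
have fs1_meas := measurableT_comp fs_meas (@measurable_path_shift m).
have fs1_ge0 w : (0 <= fstar f (path_shift w))%E by exact: fs_ge0.
have fs1_le w := fstar_shift f w.
have sub := Xw_le Moo_limit fs1_meas fs_meas fs1_ge0 fs1_le.
move=> k c s Xs.
have := Jw_le K_posdef K_le_LK Moo_limit fs1_meas fs_meas fs1_ge0 fs1_le c Xs.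
have J1 a b := Jw_shift K_posdef K_le_LK mu_uniform mu_indep Moo_limit
  fs_ge0 fs_meas (sub _ (Xs a)) (sub _ (Xs b)).
by under eq_bigr do under eq_bigr do rewrite J1.
Qed.
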